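(* Let $0<a<b$ be real numbers and let $s\in(0,1]$. Then $$\left|L_s^s(a,b)+\frac{(s-1)G^2(a,b)L_{s-2}^{s-2}(a,b)-A^s(a,b)}{2}\right|$$ $$\le \frac{s\left[\left(ab^{s-1}+a^{s-1}b\right)\left(s2^{s+1}+s+2\right)+\left(a^s+b^s\right)\left(2^{s+2}-s-2\right)\right]}{2^{s+2}(s+1)(s+2)},$$ where for $s=1$ the term $(s-1)G^2(a,b)L_{s-2}^{s-2}(a,b)$ is read as $0$.
   Context: For $0<u<v$: $A(u,v)=\frac{u+v}{2}$ (arithmetic mean), $G(u,v)=\sqrt{uv}$ (geometric mean), and for real $p\neq -1,0$, $L_p(u,v)=\left(\frac{v^{p+1}-u^{p+1}}{(p+1)(v-u)}\right)^{1/p}$ (generalized logarithmic mean). Exponents on means denote powers of their values: $A^r(u,v)=(A(u,v))^r$, $G^2(u,v)=(G(u,v))^2=uv$, and $L_p^p(u,v)=(L_p(u,v))^p=\frac{v^{p+1}-u^{p+1}}{(p+1)(v-u)}$. *)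

(* Defs.v *)
From Stdlib Require Import Reals.
Open Scope R_scope.

(* The means are meant for 0 < u < v; real powers of positive reals are
   written with Rpower x y = exp (y * ln x). *)

Definition arith_mean (u v : R) : R := (u + v) / 2.

Definition geom_mean (u v : R) : R := sqrt (u * v).

(* Generalized logarithmic mean L_p, for p <> -1 and p <> 0.  At the two excluded
   exponents division by zero makes the value unspecified, so it carries no
   meaning; in particular a product 0 * L_(-1) is still 0. *)
Definition gen_log_mean (p u v : R) : R :=
  Rpower ((Rpower v (p + 1) - Rpower u (p + 1)) / ((p + 1) * (v - u))) (1 / p).

(* Main.v *)
Require Import Defs.
From Stdlib Require Import Reals Lra.
From Coquelicot Require Import Coquelicot.
Open Scope R_scope.

(** Put [m = (a+b)/2] and [f x = x^s].  Unfolding the means, the quantity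
    inside the absolute value is
    [E = (int_a^b f + (a f(b) - b f(a))/2 - (b-a) f(m)/2) / (b-a)],
    which an integration by parts rewrites as
    [(b-a) E = int_a^m (a + b/2 - x) f'(x) dx + int_m^b (b + a/2 - x) f'(x) dx].
    Both kernels are nonnegative, being at least [a/2] on their intervals, and
    so is [f'], hence [E >= 0] and only an upper bound is at stake.

    Since [s <= 1], [f'(x) = s x^(s-1)] is convex and lies below its chord.
    Integrating the kernels against the chord gives
    [E <= s (7/48 (a b^(s-1) + a^(s-1) b) + 5/48 (a^s + b^s))].
    This is the claimed bound with its two coefficients evaluated at exponent 1,
    and the coefficients at [s] are at least as large.  That last comparison
    reduces to [1/(1 - s/2) <= 2^s <= 1 + s], two instances of Bernoulli's
    inequality [x^s <= 1 + s (x-1)].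

    The integrals appear only through explicit antiderivatives, compared by
    the mean value theorem: [kernel_bounds] does this on one interval, for a
    kernel [c - x] with arbitrary [c]. *)

(** * Real powers: algebra and convexity *)

Lemma Rpower_mult_self (x p : R) : 0 < x -> x * Rpower x p = Rpower x (p + 1).
Proof.
  intros hx. rewrite Rpower_plus, Rpower_1 by exact hx. ring.
Qed.

Lemma Rpower_div_self (x p : R) : 0 < x -> Rpower x p / x = Rpower x (p - 1).
Proof.
  intros hx. replace p with (p - 1 + 1) at 1 by ring.
  rewrite <- Rpower_mult_self by exact hx. field. lra.
Qed.

Lemma Rpower_root (x p : R) : 0 < x -> p <> 0 -> Rpower (Rpower x (1 / p)) p = x.
Proof.
  intros hx hp. rewrite Rpower_mult.
  replace (1 / p * p) with 1 by (field; exact hp). apply Rpower_1, hx.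
Qed.

Lemma ln_le_minus_1 (x : R) : 0 < x -> ln x <= x - 1.
Proof.
  intros hx. pose proof (exp_ineq1_le (ln x)) as h.
  rewrite exp_ln in h by exact hx. lra.
Qed.

(** Bernoulli's inequality is the convexity of [exp] between [0] and [ln x]. *)
Lemma Rpower_bernoulli (x s : R) :
  0 < x -> 0 <= s <= 1 -> Rpower x s <= 1 + s * (x - 1).
Proof.
  intros hx hs. unfold Rpower. set (L := ln x).
  (* both end points against the tangent of [exp] at [s * L] *)
  assert (h0 : exp (s * L) * (1 - s * L) <= 1).
  { replace 1 with (exp (s * L) * exp (- (s * L))) at 2
      by (rewrite <- exp_plus, Rplus_opp_r; apply exp_0).
    apply Rmult_le_compat_l; [left; apply exp_pos |].
    pose proof (exp_ineq1_le (- (s * L))). lra. }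
  assert (h1 : exp (s * L) * (1 + (L - s * L)) <= x).
  { replace x with (exp (s * L) * exp (L - s * L)).
    - apply Rmult_le_compat_l; [left; apply exp_pos | apply exp_ineq1_le].
    - rewrite <- exp_plus. replace (s * L + (L - s * L)) with L by ring.
      apply exp_ln, hx. }
  nra.
Qed.

(** With [r = x/y], this is [r^p >= 1 + p ln r >= 1 + p (r - 1)], the second
    step because [p <= 0]. *)
Lemma Rpower_ge_tangent (x y p : R) :
  0 < x -> 0 < y -> p <= 0 ->
  Rpower y p * (1 + p * (x / y - 1)) <= Rpower x p.
Proof.
  intros hx hy hp.
  assert (hr : 0 < x / y) by (apply Rdiv_lt_0_compat; assumption).
  replace x with (y * (x / y)) at 2 by (field; lra).
  rewrite <- Rpower_mult_distr by assumption.
  apply Rmult_le_compat_l; [left; apply exp_pos |].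
  pose proof (exp_ineq1_le (p * ln (x / y))).
  pose proof (ln_le_minus_1 _ hr). unfold Rpower. nra.
Qed.

(** Weighted average of the tangent inequalities at [x] toward [a] and [b]. *)
Lemma Rpower_le_chord (a b x p : R) :
  0 < a -> a < b -> a <= x <= b -> p <= 0 ->
  Rpower x p <= ((b - x) * Rpower a p + (x - a) * Rpower b p) / (b - a).
Proof.
  intros ha hab hx hp.
  assert (ta := Rpower_ge_tangent a x p ha ltac:(lra) hp).
  assert (tb := Rpower_ge_tangent b x p ltac:(lra) ltac:(lra) hp).
  apply Rle_div_r; [lra |].
  apply Rmult_le_compat_l with (r := b - x) in ta; [| lra].
  apply Rmult_le_compat_l with (r := x - a) in tb; [| lra].
  apply Rle_trans with (2 := Rplus_le_compat _ _ _ _ ta tb).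
  right. field. lra.
Qed.

(** * Integrating a linear kernel against a power and its chord *)

Lemma increment_le (F G f g : R -> R) (u v : R) :
  u < v ->
  (forall x, u <= x <= v -> is_derive F x (f x)) ->
  (forall x, u <= x <= v -> is_derive G x (g x)) ->
  (forall x, u <= x <= v -> f x <= g x) ->
  F v - F u <= G v - G u.
Proof.
  intros huv hF hG hfg.
  destruct (MVT_cor2 (fun x => G x - F x) (fun x => g x - f x) u v huv)
    as (x & hx & hxuv).
  - intros x hx. apply is_derive_Reals.
    apply (is_derive_minus G F); [apply hG | apply hF]; exact hx.
  - assert (hle : f x <= g x) by (apply hfg; lra). nra.
Qed.

(** Antiderivative of [(c - x) * (s * x^(s-1))], found by parts. *)
Definition power_primitive (s c x : R) : R :=
  (c - x) * Rpower x s + Rpower x (s + 1) / (s + 1).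

(** Antiderivative of [c - x] times the affine function with values [A] at
    [a] and [B] at [b]: if that function is [P + Q x], the integrand is
    [c P + (c Q - P) x - Q x^2]. *)
Definition chord_primitive (a b A B c x : R) : R :=
  let P := (b * A - a * B) / (b - a) in
  let Q := (B - A) / (b - a) in
  c * P * x + (c * Q - P) * x ^ 2 / 2 - Q * x ^ 3 / 3.

Lemma is_derive_power_primitive (s c x : R) :
  0 < x -> s + 1 <> 0 ->
  is_derive (power_primitive s c) x ((c - x) * (s * Rpower x (s - 1))).
Proof.
  intros hx hs. unfold power_primitive, Rpower at 1 2.
  auto_derive; [repeat split; lra |].
  change (exp (s * ln x)) with (Rpower x s).
  change (exp ((s + 1) * ln x)) with (Rpower x (s + 1)).
  rewrite <- Rpower_mult_self, <- Rpower_div_self by exact hx.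
  field. split; lra.
Qed.

Lemma is_derive_chord_primitive (a b A B c x : R) :
  a < b ->
  is_derive (chord_primitive a b A B c) x
    ((c - x) * (((b - x) * A + (x - a) * B) / (b - a))).
Proof.
  intros hab. unfold chord_primitive. auto_derive; [trivial |]. field. lra.
Qed.

(** The kernel [c - x] is nonnegative on [[u, v]], so it preserves
    [0 <= x^(s-1) <= chord]. *)
Lemma kernel_bounds (a b s c u v : R) :
  0 < a -> a < b -> 0 < s <= 1 -> a <= u -> u < v -> v <= b -> v <= c ->
  let A := Rpower a (s - 1) in
  let B := Rpower b (s - 1) in
  0 <= power_primitive s c v - power_primitive s c u
    <= s * (chord_primitive a b A B c v - chord_primitive a b A B c u).
Proof.
  intros ha hab hs hau huv hvb hvc A B.
  assert (hF : forall x, u <= x <= v ->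
    is_derive (power_primitive s c) x ((c - x) * (s * Rpower x (s - 1))))
    by (intros x hx; apply is_derive_power_primitive; lra).
  split.
  - replace 0 with (0 - 0) by ring.
    apply (increment_le (fun _ => 0) _ (fun _ => 0) _ u v huv) with (2 := hF).
    + intros x _. apply @is_derive_const.
    + intros x hx. pose proof (exp_pos ((s - 1) * ln x)) as hpos.
      apply Rmult_le_pos; [lra |]. apply Rmult_le_pos; [lra |].
      left. exact hpos.
  - rewrite Rmult_minus_distr_l.
    apply (increment_le _ (fun x => s * chord_primitive a b A B c x) _
      (fun x => s * ((c - x) * (((b - x) * A + (x - a) * B) / (b - a))))
      u v huv hF).
    + intros x _.
      apply is_derive_scal, is_derive_chord_primitive, hab.
    + intros x hx.
      assert (h : Rpower x (s - 1) <= ((b - x) * A + (x - a) * B) / (b - a))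
        by (apply Rpower_le_chord; lra).
      rewrite <- Rmult_assoc, (Rmult_comm (c - x) s), Rmult_assoc.
      apply Rmult_le_compat_l; [lra |].
      apply Rmult_le_compat_l; [lra | exact h].
Qed.

(** The two intervals [[a, m]] and [[m, b]] with the kernels that produce the
    boundary terms [a f(b)/2], [- b f(a)/2] and [- (b-a) f(m)/2]. *)
Lemma midpoint_defect_bounds (a b s : R) :
  0 < a -> a < b -> 0 < s <= 1 ->
  let E := (Rpower b (s + 1) - Rpower a (s + 1)) / ((s + 1) * (b - a))
           + ((a * Rpower b s - b * Rpower a s) / (b - a)
              - Rpower ((a + b) / 2) s) / 2 in
  0 <= E <=
    s * (7 / 48 * (a * Rpower b (s - 1) + Rpower a (s - 1) * b)
         + 5 / 48 * (Rpower a s + Rpower b s)).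
Proof.
  intros ha hab hs E. set (m := (a + b) / 2).
  assert (hl := kernel_bounds a b s (a + b / 2) a m ha hab hs
    ltac:(lra) ltac:(unfold m; lra) ltac:(unfold m; lra) ltac:(unfold m; lra)).
  assert (hr := kernel_bounds a b s (b + a / 2) m b ha hab hs
    ltac:(unfold m; lra) ltac:(unfold m; lra) ltac:(lra) ltac:(lra)).
  cbv zeta in hl, hr.
  assert (hE : E * (b - a)
    = (power_primitive s (a + b / 2) m - power_primitive s (a + b / 2) a)
      + (power_primitive s (b + a / 2) b - power_primitive s (b + a / 2) m)).
  { unfold E, power_primitive. fold m.
    replace (a + b / 2 - m) with (a / 2) by (unfold m; field).
    replace (b + a / 2 - m) with (b / 2) by (unfold m; field).
    field. lra. }
  split; apply Rmult_le_reg_r with (b - a); try lra.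
  rewrite hE.
  apply Rle_trans
    with (1 := Rplus_le_compat _ _ _ _ (proj2 hl) (proj2 hr)).
  replace (Rpower a s) with (a * Rpower a (s - 1))
    by (rewrite Rpower_mult_self by lra; f_equal; ring).
  replace (Rpower b s) with (b * Rpower b (s - 1))
    by (rewrite Rpower_mult_self by lra; f_equal; ring).
  right. unfold chord_primitive, m. field. lra.
Qed.

(** * Comparison of the coefficients *)

Lemma Rpower_2_bounds (s : R) :
  0 <= s <= 1 -> Rpower 2 s <= 1 + s /\ 1 <= Rpower 2 s * (1 - s / 2).
Proof.
  intros hs. split.
  - pose proof (Rpower_bernoulli 2 s ltac:(lra) hs). lra.
  - pose proof (Rpower_bernoulli (/ 2) s ltac:(lra) hs) as h.
    assert (hinv : Rpower 2 s * Rpower (/ 2) s = 1).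
    { rewrite Rpower_mult_distr by lra. rewrite Rinv_r by lra.
      unfold Rpower. rewrite ln_1, Rmult_0_r. apply exp_0. }
    rewrite <- hinv. apply Rmult_le_compat_l; [left; apply exp_pos | lra].
Qed.

(** With [y = 2^s], the right-hand sides are integrals over [[0, 1]] of [t^s]
    against nonnegative piecewise affine weights, hence decreasing in [s], and
    they equal the left-hand ones at [s = 1].  Once the bounds on [y] are
    inserted, the differences have a factor [1 - s] and are otherwise
    positive. *)
Lemma coefficient_bounds (s y : R) :
  0 < s <= 1 -> 0 < y -> y <= 1 + s -> 1 <= y * (1 - s / 2) ->
  7 / 48 <= (2 * s * y + s + 2) / (4 * y * (s + 1) * (s + 2)) /\
  5 / 48 <= (4 * y - s - 2) / (4 * y * (s + 1) * (s + 2)).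
Proof.
  intros hs hy hy1 hy2.
  assert (hd : 0 < 4 * y * (s + 1) * (s + 2))
    by (repeat apply Rmult_lt_0_compat; lra).
  split; apply (Rle_div_r _ _ _ hd).
  - assert (h1 : y * (7 * s ^ 2 - 3 * s + 14)
                 <= (1 + s) * (7 * s ^ 2 - 3 * s + 14))
      by (apply Rmult_le_compat_r; nra).
    assert (h2 : 0 <= (1 - s) * (7 * s ^ 2 + 11 * s + 10))
      by (apply Rmult_le_pos; nra).
    nra.
  - assert (h1 : 12 * (s + 2) * 1 <= 12 * (s + 2) * (y * (1 - s / 2)))
      by (apply Rmult_le_compat_l; lra).
    assert (h2 : 0 <= y * ((1 - s) * (14 - s)))
      by (repeat apply Rmult_le_pos; lra).
    nra.
Qed.

(** * Powers of the generalized logarithmic means *)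

Lemma gen_log_mean_pow (p u v : R) :
  p <> 0 -> 0 < (Rpower v (p + 1) - Rpower u (p + 1)) / ((p + 1) * (v - u)) ->
  Rpower (gen_log_mean p u v) p
  = (Rpower v (p + 1) - Rpower u (p + 1)) / ((p + 1) * (v - u)).
Proof.
  intros hp hpos. apply Rpower_root; assumption.
Qed.

Lemma Rpower_lt_anti (u v p : R) :
  0 < u -> u < v -> p < 0 -> Rpower v p < Rpower u p.
Proof.
  intros hu huv hp. apply exp_increasing.
  pose proof (ln_increasing u v hu huv). nra.
Qed.

(** Both means cancel against [s - 1] and [ab]; in this form the exceptional
    exponent [s = 1] needs no convention. *)
Lemma log_mean_defect_term (a b s : R) :
  0 < a -> a < b -> 0 < s <= 1 ->
  (s - 1) * (geom_mean a b) ^ 2 * Rpower (gen_log_mean (s - 2) a b) (s - 2)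
  = (a * Rpower b s - b * Rpower a s) / (b - a).
Proof.
  intros ha hab hs.
  destruct (Req_dec s 1) as [-> | hne].
  { (* both sides vanish *)
    rewrite !Rpower_1 by lra. field. lra. }
  assert (hG : geom_mean a b ^ 2 = a * b) by (apply pow2_sqrt; nra).
  rewrite hG, gen_log_mean_pow;
    replace (s - 2 + 1) with (s - 1) by ring; [| lra |].
  - replace (Rpower a s) with (a * Rpower a (s - 1))
      by (rewrite Rpower_mult_self by lra; f_equal; ring).
    replace (Rpower b s) with (b * Rpower b (s - 1))
      by (rewrite Rpower_mult_self by lra; f_equal; ring).
    field. lra.
  - (* numerator and denominator are both negative *)
    pose proof (Rpower_lt_anti a b (s - 1) ha hab ltac:(lra)).
    replace (_ / _) with
      ((Rpower a (s - 1) - Rpower b (s - 1)) / ((1 - s) * (b - a)))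
      by (field; lra).
    apply Rdiv_lt_0_compat; [lra |]. apply Rmult_lt_0_compat; lra.
Qed.

Theorem proposition1 (a b s : R) (ha : 0 < a) (hab : a < b)
    (hs0 : 0 < s) (hs1 : s <= 1) :
  Rabs (Rpower (gen_log_mean s a b) s
        + ((s - 1) * (geom_mean a b) ^ 2
             * Rpower (gen_log_mean (s - 2) a b) (s - 2)
           - Rpower (arith_mean a b) s) / 2)
  <= s * ((a * Rpower b (s - 1) + Rpower a (s - 1) * b)
            * (s * Rpower 2 (s + 1) + s + 2)
          + (Rpower a s + Rpower b s) * (Rpower 2 (s + 2) - s - 2))
     / (Rpower 2 (s + 2) * (s + 1) * (s + 2)).
Proof.
  assert (hs : 0 < s <= 1) by lra.
  assert (hL : 0 < (Rpower b (s + 1) - Rpower a (s + 1)) / ((s + 1) * (b - a))).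
  { apply Rdiv_lt_0_compat; [| nra].
    apply Rlt_0_minus, Rlt_Rpower_l; lra. }
  rewrite log_mean_defect_term, gen_log_mean_pow by (assumption || lra).
  unfold arith_mean.
  destruct (midpoint_defect_bounds a b s ha hab hs) as [hE0 hE1].
  rewrite Rabs_pos_eq by exact hE0.
  apply Rle_trans with (1 := hE1).
  replace (Rpower 2 (s + 2)) with (4 * Rpower 2 s)
    by (rewrite Rpower_plus; replace 2 with (INR 2) at 4 by reflexivity;
        rewrite Rpower_pow by lra; ring).
  rewrite <- (Rpower_mult_self 2 s) by lra.
  destruct (Rpower_2_bounds s ltac:(lra)) as [hy1 hy2].
  assert (hy : 0 < Rpower 2 s) by apply exp_pos.
  destruct (coefficient_bounds s _ hs hy hy1 hy2) as [h7 h5].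
  set (y := Rpower 2 s) in *.
  set (U := a * Rpower b (s - 1) + Rpower a (s - 1) * b).
  set (V := Rpower a s + Rpower b s).
  assert (hU : 0 <= U) by (apply Rplus_le_le_0_compat; apply Rmult_le_pos;
    unfold Rpower; try (left; apply exp_pos); lra).
  assert (hV : 0 <= V) by (apply Rplus_le_le_0_compat; left; apply exp_pos).
  replace (s * (U * (s * (2 * y) + s + 2) + V * (4 * y - s - 2))
           / (4 * y * (s + 1) * (s + 2)))
    with (s * ((2 * s * y + s + 2) / (4 * y * (s + 1) * (s + 2)) * U
               + (4 * y - s - 2) / (4 * y * (s + 1) * (s + 2)) * V))
    by (field; lra).
  apply Rmult_le_compat_l; [lra |].
  apply Rplus_le_compat; apply Rmult_le_compat_r; assumption.
Qed.
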